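(* Every $e$-open space is locally equiconnected.
   Context: ''Space'' means compact metrizable space and ''map'' means continuous function. A space pair is a pair $(Y,Z)$ where $Y$ is a space and $Z\subseteq Y$ is a closed subspace. For spaces $X,Z$, $X^Z$ denotes the set of maps from $Z$ to $X$ with the topology of uniform convergence (equivalently, the compact-open topology). For a space pair $(Y,Z)$, $X^{Z\uparrow Y}\subseteq X^Z$ denotes the set of maps from $Z$ to $X$ which extend to a map from $Y$ to $X$. A space $X$ is $e$-open if, for every space pair $(Y,Z)$, the set $X^{Z\uparrow Y}$ is open in $X^Z$. A space $X$ is locally equiconnected if there are a neighborhood $W$ of the diagonal in $X\times X$ and a continuous map $\lambda:W\times[0,1]\to X$ such that $\lambda(x,y,0)=x$ and $\lambda(x,y,1)=y$ for all $(x,y)\in W$, and $\lambda(x,x,t)=x$ for all $x\in X$ and $t\in[0,1]$. *)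

(* Defs.v *)
From HB Require Import structures.
From mathcomp Require Import all_boot all_order all_algebra.
From mathcomp Require Import all_classical all_reals all_analysis.

Set Implicit Arguments.
Unset Strict Implicit.
Unset Printing Implicit Defensive.

Import Order.TTheory GRing.Theory Num.Theory.
Import numFieldNormedType.Exports.

Local Open Scope classical_set_scope.
Local Open Scope ring_scope.

Definition is_metric (R : realType) (T : Type) (d : T -> T -> R) : Prop :=
  [/\ forall x y, 0 <= d x y,
      forall x y, d x y = 0 <-> x = y,
      forall x y, d x y = d y x &
      forall x y z, d x z <= d x y + d y z].

Definition metrizable (R : realType) (T : topologicalType) : Prop :=
  exists2 d : T -> T -> R, is_metric d &
    forall x : T,
      nbhs x = filter_from [set e : R | 0 < e] (fun e => [set y | d x y < e]).

Definition compact_metrizable (R : realType) (T : topologicalType) : Prop :=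
  compact [set: T] /\ metrizable R T.

(* [X^Z]; [initial_topology _] is a copy of its source type [continuousType Z X]
   carrying the topology induced by the inclusion into the space of all
   functions.  For compact [Z] and metrizable [X] this is the topology of
   uniform convergence. *)
Definition mapping_space (Z X : topologicalType) : topologicalType :=
  initial_topology
    (fun f : continuousType Z X => (f : Z -> X) : {compact-open, Z -> X}).

(* [X^{Z↑Y}]; the set [Z] is coerced to the subtype [set_type Z], which has
   the subspace topology. *)
Definition extendable_maps (Y : topologicalType) (Z : set Y)
    (X : topologicalType) : set (mapping_space Z X) :=
  [set f : continuousType Z X |
    exists g : continuousType Y X, forall z : Z, g (set_val z) = f z].

Definition e_open (R : realType) (X : topologicalType) : Prop :=
  forall (Y : topologicalType) (Z : set Y),
    compact_metrizable R Y -> closed Z -> open (@extendable_maps Y Z X).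

(* A map defined on [W * [0, 1]] is represented by a total function that is
   continuous on the subspace [W `*` `[0, 1]]; its values elsewhere are
   irrelevant. *)
Definition locally_equiconnected (R : realType) (X : topologicalType) : Prop :=
  exists (W : set (X * X)) (lambda : X * X * R -> X),
    [/\ set_nbhs diagonal W,
        {within W `*` `[0, 1], continuous lambda},
        forall x y, W (x, y) -> lambda (x, y, 0) = x /\ lambda (x, y, 1) = y &
        forall x t, t \in `[0, 1] -> lambda (x, x, t) = x].

(* Main.v *)
Require Import Defs.
From mathcomp Require Import all_boot all_order all_algebra.
From mathcomp Require Import all_classical all_reals all_analysis.
From mathcomp Require Import lra.

(** An equiconnecting map for [X] is a path from [x] to [y], continuous in
    the pair [(x, y)] and constant on the diagonal, defined for close [x] and
    [y].  The existence of such a map is a problem of extension from the ends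
    of the time interval; openness is used by solving this problem at
    infinitely many scales at once, inside a single space pair.

    Let [Y = X * X * [0, 1]], and let [c_n = 1 / (n + 1)].  The closed subset
    [track] of [Y] consists of the points [(x, x, u)] together with the points
    [(x, y, u)] at the levels [u = 0] and [u = c_n] that satisfy
    [d x y <= u].  On [track] consider the map [switch n], which sends
    [(x, y, u)] to [y] at level [c_n] and to [x] elsewhere.  It is continuous
    ([switch_continuous]), because over a point off the diagonal the levels
    are isolated ([levels_isolated]), and it is within [c_n] of the
    projection [(x, y, u) |-> x] ([switch_close]).  Hence [switch n] tends to
    this projection in the mapping space ([cvg_mapping_space]).  The projection
    obviously extends to [Y], so by e-openness some [switch n] extends to a
    continuous [g] on [Y] ([switch_extends]).

    For [d x y <= c_(n+1)], the map [u |-> g (x, y, u)] equals [x] at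
    [u = c_(n+1)] and [y] at [u = c_n], and it is constant if [x = y].
    Reparametrizing [[c_(n+1), c_n]] by [[0, 1]] gives the required map. *)

Set Implicit Arguments.
Unset Strict Implicit.
Unset Printing Implicit Defensive.

Import Order.TTheory GRing.Theory Num.Theory.
Import numFieldNormedType.Exports.

Local Open Scope classical_set_scope.
Local Open Scope ring_scope.

(** * Metrics inducing a topology *)

Definition metrizes (R : realType) (X : topologicalType) (d : X -> X -> R) :=
  is_metric d /\ forall x : X,
    nbhs x = filter_from [set e : R | 0 < e] (fun e => [set y | d x y < e]).

Lemma near_metric (R : realType) (X : topologicalType) (d : X -> X -> R)
    (x : X) (e : R) :
  metrizes d -> 0 < e -> \forall y \near x, d x y < e.
Proof.
move=> [_ nX] e0; suff: nbhs x [set y | d x y < e] by [].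
by rewrite nX; exists e.
Qed.

Lemma metric_continuous (R : realType) (X : topologicalType)
    (d : X -> X -> R) :
  metrizes d -> continuous (fun p : X * X => d p.1 p.2).
Proof.
move=> dX; have [[_ _ dC dT] _] := dX.
move=> [x y]; apply/cvgrPdist_lt => e e0 /=.
have e2 : 0 < e / 2 by rewrite divr_gt0.
exists ([set x' | d x x' < e / 2], [set y' | d y y' < e / 2]) => /=.
  by split; exact: near_metric.
move=> [x' y'] /= [xx yy].
have := dT x x' y; have := dT x' y' y; have := dT x' x y; have := dT x y y'.
have := dT x' x y'.
rewrite (dC x' x) (dC y' y) ltr_norml; lra.
Qed.

Lemma compact_metrizable_prod (R : realType) (X Y : topologicalType) :
  compact_metrizable R X -> compact_metrizable R Y ->
  compact_metrizable R (X * Y)%type.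
Proof.
move=> [cX [d [d0 dE dC dT] nX]] [cY [e [e0 eE eC eT] nY]]; split.
  by rewrite -setXTT; exact: compact_setX.
exists (fun p q => Num.max (d p.1 q.1) (e p.2 q.2)).
  split=> [p q|[x y] [x' y']|p q|p q r].
  - by rewrite le_max d0.
  - split=> [/= m0|[-> ->] /=]; last by rewrite (dE _ _).2// (eE _ _).2// maxxx.
    have m1 : Num.max (d x x') (e y y') <= 0 by rewrite m0.
    move: m1; rewrite ge_max => /andP[d1 e1]; congr pair.
      by apply/dE/le_anti; rewrite d1 d0.
    by apply/eE/le_anti; rewrite e1 e0.
  - by rewrite dC eC.
  - rewrite ge_max; apply/andP; split.
      by apply: le_trans (dT _ q.1 _) _; rewrite lerD// le_max lexx.
    by apply: le_trans (eT _ q.2 _) _; rewrite lerD// le_max lexx orbT.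
move=> [x y]; rewrite eqEsubset; split=> U.
  move=> [[A B] /= []]; rewrite nX nY => -[a /= a0 aA] [b /= b0 bB] AB.
  exists (Num.min a b); first by rewrite /= lt_min a0.
  move=> [x' y'] /=; rewrite gt_max !lt_min => /andP[/andP[xa _] /andP[_ yb]].
  by apply: AB; split; [exact: aA|exact: bB].
move=> [a /= a0 aU].
exists ([set x' | d x x' < a], [set y' | e y y' < a]) => /=.
  by split; rewrite ?nX ?nY; exists a.
by move=> [x' y'] /= [xa ya]; apply: aU; rewrite /= gt_max xa.
Qed.

(** * The unit interval as a space *)

Local Notation unit_interval R := (set_type `[0, 1 : R]%classic).

Definition clamp (R : realType) (u : R) : R := Num.max 0 (Num.min 1 u).

Lemma clamp_itv (R : realType) (u : R) : clamp u \in `[0, 1]%classic.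
Proof.
by rewrite inE /= in_itv /= le_max lexx /= ge_max ler01 ge_min lexx.
Qed.

(** The retraction of the line onto the interval, with values in the subtype.
    It transfers compactness of the segment to the subtype, and it turns a map
    on the subtype into one defined for all real times. *)
Definition clampI (R : realType) (u : R) : unit_interval R :=
  exist _ (clamp u) (clamp_itv u).

Lemma clampIK (R : realType) (u : R) : 0 <= u <= 1 -> set_val (clampI u) = u.
Proof.
by move=> /andP[u0 u1]; rewrite set_valE /= /clamp (min_idPr u1) (max_idPr u0).
Qed.

Lemma clampI_continuous (R : realType) : continuous (@clampI R).
Proof.
apply: continuous_comp_initial => u.
apply: (@continuous_max R R (cst 0) (Num.min 1)); first exact: cvg_cst.
by apply: (@continuous_min R R (cst 1) id); [exact: cvg_cst|exact: cvg_id].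
Qed.

Lemma compact_metrizable_unit_interval (R : realType) :
  compact_metrizable R (unit_interval R).
Proof.
split.
  have -> : [set: unit_interval R] = @clampI R @` `[0, 1].
    apply/seteqP; split=> // -[u hu] _; have /set_mem /= u01 := hu.
    exists u => //; apply/val_inj; rewrite /=.
    by apply: clampIK; rewrite in_itv /= in u01.
  apply: continuous_compact (@segment_compact _ _ _).
  exact/continuous_subspaceT/clampI_continuous.
exists (fun u v => `|set_val u - set_val v|).
  split=> [u v|u v|u v|u v w].
  - exact: normr_ge0.
  - split=> [/eqP|->]; last by rewrite subrr normr0.
    by rewrite normr_eq0 subr_eq0 => /eqP uv; apply: val_inj.
  - exact: distrC.
  - exact: ler_distD.
by move=> u; rewrite -nbhs_ballE.
Qed.

(** * The levels *)

Definition levels (R : realType) : set R :=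
  [set u | u = 0 \/ exists n, u = harmonic n].

(** Only finitely many levels lie above a given positive height, so near
    [u > 0] it suffices to avoid finitely many points other than [u]. *)
Lemma levels_isolated (R : realType) (u : R) :
  0 < u -> \forall v \near u, levels v -> v = u.
Proof.
move=> u0.
have [N _ /(_ _ (leqnn N)) /= NU] : \forall n \near \oo, harmonic n < u.
  by apply: (cvgr_lt (0 : R)); [exact: cvg_harmonic|].
have Nn (n : nat) : harmonic N < harmonic n :> R -> (n < N)%N.
  by rewrite /= ltf_pV2 ?posrE ?ltr0n// ltr_nat.
near=> v.
have vN : harmonic N < v by near: v; exact: lt_nbhsr.
have vi : forall i : 'I_N, harmonic i != u -> v != harmonic i.
  near: v; apply: filter_forall => i.
  have [_|iu] := eqVneq (harmonic i) u; first by apply: nearW.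
  suff: nbhs u [set w | w != harmonic i] by apply: filterS.
  apply: open_nbhs_nbhs; split; last by rewrite /= eq_sym.
  exact: open_neq.
move=> [v0|[n vn]]; first by move: vN; rewrite v0 ltNge harmonic_ge0.
rewrite vn in vN; have nN := Nn _ vN.
have [<-//|/(vi (Ordinal nN))] := eqVneq (harmonic n) u.
by rewrite vn eqxx.
Unshelve. all: by end_near. Qed.

Lemma levels_closed (R : realType) : closed (@levels R).
Proof.
move=> u cu; have [u0|u0|->] := ltgtP u 0; last by left.
- have [v [lv v0]] := cu _ (lt_nbhsl u0).
  by case: lv v0 => [->|[n ->]]; rewrite ltNge ?lexx ?harmonic_ge0.
- by have [v [lv /(_ lv) <-]] := cu _ (levels_isolated u0).
Qed.

(** * Uniform convergence in the mapping space *)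

(** Given a compact [K] that [f] sends into the open [O], the condition that
    [F i z] lies in [O] holds jointly for [z] near a point of [K] and [i] far
    enough; compactness makes it uniform on [K]. *)
Lemma cvg_mapping_space (R : realType) (X : topologicalType)
    (d : X -> X -> R) (Z : topologicalType) (I : Type) (G : set_system I)
    (F : I -> continuousType Z X) (f : continuousType Z X) :
  metrizes d -> Filter G ->
  (forall e : R, 0 < e ->
    \forall i \near G, forall z, d (f z) (F i z) < e) ->
  (F i : mapping_space Z X) @[i --> G] --> (f : mapping_space Z X).
Proof.
move=> dX GF Ff; have [[_ _ _ dT] nX] := dX.
have cF : (F i : {compact-open, Z -> X}) @[i --> G]
    --> (f : {compact-open, Z -> X}).
  apply/compact_open_cvgP => K O cK oO fKO.
  have near_cover :=
    (compact_near_coveringP K).1 cK I G (fun i z => O (F i z)) GF.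
  suff: \near G, K `<=` (fun z => O (F G z)).
    by apply: filterS => i KO _ [z Kz <-]; exact: KO.
  apply: near_cover => z Kz.
  have : nbhs (f z) O by apply: open_nbhs_nbhs; split=> //; apply: fKO; exists z.
  rewrite nX => -[e /= e0 eO].
  have e2 : 0 < e / 2 by rewrite divr_gt0.
  exists ([set z' | d (f z) (f z') < e / 2],
          [set i | forall z', d (f z') (F i z') < e / 2]) => /=.
    split; last exact: Ff.
    have cf : continuous f by exact: cts_fun.
    by apply: (cf z [set y | d (f z) y < e / 2]); exact: near_metric.
  move=> [z' i] /= [zz zi]; apply: eO => /=.
  by rewrite (splitr e); apply: le_lt_trans (dT _ (f z') _) _; rewrite ltrD.
move=> A [B [/= [C oC <-] Bf BA]].
have nC : nbhs (f : {compact-open, Z -> X}) C by exact: open_nbhs_nbhs.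
have GC : \forall i \near G, C (F i : Z -> X) := cF C nC.
suff : \forall i \near G, A (F i) by [].
by apply: filterS GC => i Ci; exact: BA.
Qed.

(** * The space pair and its maps *)

Local Notation cylinder R X := (X * X * unit_interval R)%type.

(** The diagonal is written [d <= 0]; the bound [d x y <= u] at a level
    [u] makes the maps [switch n] converge uniformly on this set. *)
Definition track (R : realType) (X : topologicalType) (d : X -> X -> R) :
    set (cylinder R X) :=
  [set p | d p.1.1 p.1.2 <= 0 \/
    levels (set_val p.2) /\ d p.1.1 p.1.2 <= set_val p.2].

Definition switch (R : realType) (X : topologicalType) (n : nat)
    (p : cylinder R X) : X :=
  if set_val p.2 == harmonic n then p.1.2 else p.1.1.

Lemma source_continuous (R : realType) (X : topologicalType) :
  continuous (fun p : cylinder R X => p.1.1).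
Proof. by move=> p; apply: (@continuous_comp _ _ _ fst fst); exact: cvg_fst. Qed.

Lemma target_continuous (R : realType) (X : topologicalType) :
  continuous (fun p : cylinder R X => p.1.2).
Proof.
by move=> p; apply: (@continuous_comp _ _ _ fst snd);
  [exact: cvg_fst|exact: cvg_snd].
Qed.

Lemma height_continuous (R : realType) (X : topologicalType) :
  continuous (fun p : cylinder R X => set_val p.2 : R).
Proof.
move=> p; apply: (@continuous_comp _ _ _ snd (@set_val _ _)).
  exact: cvg_snd.
exact: initial_continuous.
Qed.

Lemma gap_continuous (R : realType) (X : topologicalType) (d : X -> X -> R) :
  metrizes d -> continuous (fun p : cylinder R X => d p.1.1 p.1.2).
Proof.
move=> dX p; apply: (@continuous_comp _ _ _ fst (fun q : X * X => d q.1 q.2)).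
  exact: cvg_fst.
exact: (metric_continuous dX).
Qed.

Lemma track_closed (R : realType) (X : topologicalType) (d : X -> X -> R) :
  metrizes d -> closed (track d).
Proof.
move=> dX; have cg := gap_continuous dX; apply: closedU.
  apply: (@preimage_closed _ _ (fun p : cylinder R X => d p.1.1 p.1.2)
    [set r | r <= 0]); last exact: closed_le.
  by move=> p _; exact: cg.
apply: closedI.
  apply: (@preimage_closed _ _ (fun p : cylinder R X => set_val p.2 : R)
    (@levels R)); last exact: levels_closed.
  by move=> p _; exact: height_continuous.
have -> : (fun p : cylinder R X => is_true (d p.1.1 p.1.2 <= set_val p.2)) =
    (fun p : cylinder R X => set_val p.2 - d p.1.1 p.1.2) @^-1`
      [set r | 0 <= r].
  by apply/seteqP; split=> p /=; rewrite subr_ge0.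
apply: preimage_closed; last exact: closed_ge.
by move=> p _; apply: cvgB; [exact: height_continuous|exact: cg].
Qed.

(** At a diagonal point both branches have the same value and are continuous.
    Off the diagonal the height is a level and all nearby points of the track
    have the same height if it is positive, so only one branch occurs. *)
Lemma switch_continuous (R : realType) (X : topologicalType)
    (d : X -> X -> R) (n : nat) :
  metrizes d -> continuous (fun z : track d => switch n (set_val z)).
Proof.
move=> dX; have [[d0 dE _ _] _] := dX.
have restrict (T : topologicalType) (h : cylinder R X -> T) :
    continuous h -> continuous (fun z : track d => h (set_val z)).
  move=> ch z; apply: (@continuous_comp _ _ _ (fun z : track d => set_val z) h).
    exact: initial_continuous.
  exact: ch.
have cl := restrict _ _ (@source_continuous R X).
have cr := restrict _ _ (@target_continuous R X).
have ch := restrict _ _ (@height_continuous R X).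
have cg := restrict _ _ (gap_continuous dX).
move=> z U nU; suff: \forall w \near z, U (switch n (set_val w)) by [].
move: nU; rewrite /switch.
have [gz|gz] := eqVneq (d (set_val z).1.1 (set_val z).1.2) 0.
  rewrite -((dE _ _).1 gz) if_same => nU.
  have nl := cl z _ nU.
  have nr : nbhs ((set_val z).1.2) U by rewrite -((dE _ _).1 gz).
  have {}nr := cr z _ nr.
  by near=> w; case: ifP => _; near: w.
have gz0 : 0 < d (set_val z).1.1 (set_val z).1.2.
  by rewrite lt_neqAle eq_sym gz d0.
have ng : \forall w \near z, 0 < d (set_val w).1.1 (set_val w).1.2.
  exact: cvgr_gt (cg z) _ gz0.
have [hz|hz] := eqVneq (set_val (set_val z).2) (harmonic n).
  move=> nU; have nr := cr z _ nU.
  have hz0 : 0 < set_val (set_val z).2 by rewrite hz harmonic_gt0.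
  have nh := ch z _ (levels_isolated hz0).
  near=> w; rewrite ifT; first by near: w.
  have gw : 0 < d (set_val w).1.1 (set_val w).1.2 by near: w.
  case: (set_valP w) => [|[lw _]]; first by rewrite leNgt gw.
  by rewrite -hz; apply/eqP; move: lw; near: w.
move=> nU; have nl := cl z _ nU.
have nh := ch z _ (open_nbhs_nbhs (conj (@open_neq _ (harmonic n)) hz)).
near=> w; rewrite ifF; first by near: w.
by apply/negbTE; near: w.
Unshelve. all: by end_near. Qed.

Lemma switch_close (R : realType) (X : topologicalType) (d : X -> X -> R)
    (n : nat) (p : cylinder R X) :
  is_metric d -> track d p -> d p.1.1 (switch n p) <= harmonic n.
Proof.
move=> [d0 dE _ _]; rewrite /switch; case: ifPn => [/eqP hp|_ _]; last first.
  by rewrite (dE _ _).2// harmonic_ge0.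
by case=> [gp|[_]]; [exact: le_trans gp (harmonic_ge0 n)|rewrite hp].
Qed.

(** The extendable maps form a neighborhood of the projection to the first
    point, and the maps [switch n] converge to this projection. *)
Lemma switch_extends (R : realType) (X : topologicalType) (d : X -> X -> R) :
  compact_metrizable R X -> e_open R X -> metrizes d ->
  exists n (g : cylinder R X -> X),
    continuous g /\ forall p, track d p -> g p = switch n p.
Proof.
move=> mX eX dX.
have mY : compact_metrizable R (cylinder R X).
  apply: compact_metrizable_prod; last exact: compact_metrizable_unit_interval.
  exact: compact_metrizable_prod.
pose F n : continuousType (track d) X := mkcts (switch_continuous (n := n) dX).
have cp := @source_continuous R X.
have cf : continuous (fun z : track d => (set_val z).1.1).
  move=> z; apply: (@continuous_comp _ _ _ (fun z : track d => set_val z)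
    (fun p : cylinder R X => p.1.1)); [exact: initial_continuous|exact: cp].
pose f : continuousType (track d) X := mkcts cf.
have Ff : (F n : mapping_space (track d) X) @[n --> \oo] -->
    (f : mapping_space (track d) X).
  apply: (cvg_mapping_space dX) => e e0.
  have : \forall n \near \oo, harmonic n < e.
    by apply: (cvgr_lt (0 : R)); [exact: cvg_harmonic|].
  apply: filterS => n ne z; apply: le_lt_trans ne.
  exact: switch_close dX.1 (set_valP z).
have fE : nbhs (f : mapping_space (track d) X)
    (@extendable_maps (cylinder R X) (track d) X).
  apply: open_nbhs_nbhs; split; first exact: eX mY (track_closed dX).
  by exists (mkcts cp).
have [n _ /(_ _ (leqnn n)) /= [g gF]] := Ff _ fE.
exists n, g; split; first exact: cts_fun.
by move=> p pt; have := gF (exist _ p (mem_set pt)).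
Qed.

(** * Local equiconnectedness *)

Theorem corollary4p5 (R : realType) (X : topologicalType) :
  compact_metrizable R X -> e_open R X -> locally_equiconnected R X.
Proof.
move=> mX eX; have [_ [d dM nX]] := mX; have [d0 dE _ _] := dM.
have dX : metrizes d by split.
have [n [g [cg gE]]] := switch_extends mX eX dX.
pose a : R := harmonic n.+1; pose b : R := harmonic n.
have a0 : 0 < a by exact: harmonic_gt0.
have b1 : b <= 1 by rewrite /b /= invf_le1 ?ler1n ?ltr0n.
have ab : a < b by rewrite /a /b /= ltf_pV2 ?posrE ?ltr0n// ltr_nat.
pose h (t : R) := a + t * (b - a).
exists [set p | d p.1 p.2 <= a], (fun p => g (p.1, clampI (h p.2))); split.
- move=> [x y] /= xy; rewrite /diagonal /= in xy; rewrite -xy.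
  have cd : continuous (fun p : X * X => d p.1 p.2).
    exact: metric_continuous dX.
  have dxa : d x x < a by rewrite (dE x x).2.
  by apply: filterS (cvgr_lt _ (cd (x, x)) _ dxa) => p /ltW.
- have ch : continuous (fun p : X * X * R => clampI (h p.2)).
    move=> p; apply: (@continuous_comp _ _ _ (fun p => h p.2) (@clampI R)).
      apply: cvgD; first exact: cvg_cst.
      by apply: cvgM; [exact: cvg_snd|exact: cvg_cst].
    exact: clampI_continuous.
  apply: continuous_subspaceT => p.
  apply: (@continuous_comp _ _ _
    (fun p : X * X * R => (p.1, clampI (h p.2))) g); last exact: cg.
  have c1 : p0.1 @[p0 --> p] --> p.1 by exact: cvg_fst.
  exact: cvg_pair c1 (ch p).
- move=> x y /= xya; rewrite /h mul0r addr0 mul1r addrC subrK.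
  have vb : set_val (clampI b) = b by apply: clampIK; lra.
  have va : set_val (clampI a) = a by apply: clampIK; lra.
  (* Both ends lie on the track because [d x y <= a < b]; only the upper one
     is the switched level. *)
  split; rewrite gE /switch /= ?vb ?va.
  + by rewrite lt_eqF.
  + by right; rewrite /= va; split=> //; right; exists n.+1.
  + by rewrite eqxx.
  + right; rewrite /= vb; split; last lra.
    by right; exists n.
- move=> x t _; rewrite gE /switch /= ?if_same//.
  by left; rewrite /= (dE _ _).2.
Qed.
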